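(* Let $\mathbf R:\mathbb R^n\to\mathbb R^m$ be continuously differentiable with Jacobian $J$ that is $L$-Lipschitz continuous on $\mathbb R^n$, i.e. $\|J(\mathbf x)-J(\mathbf y)\|\le L\|\mathbf x-\mathbf y\|$ for all $\mathbf x,\mathbf y\in\mathbb R^n$. Consider Algorithm PILM (with line search) with $\ell_k\ge\ell$ for every $k$, with $\{\varepsilon_k\}$ a sequence of positive numbers such that $\sum_{k=0}^\infty\varepsilon_k<+\infty$, and with $\mu_k=\max\{\mu_{\min},\,C_\mu\|B^k\|\}$ for every $k$, where $\mu_{\min}>0$ and $C_\mu>1$. Then for $\ell$ large enough (i.e. there is $\bar\ell\in\mathbb N$ such that for $\ell\ge\bar\ell$) we have that for every $\mathbf x^0\in\mathbb R^n$, each accumulation point of the sequence $\{\mathbf x^k\}$ generated by the algorithm from $\mathbf x^0$ is a stationary point of $F$.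
   Context: Norms are Euclidean 2-norms (spectral norm for matrices). $\mathbf R=(r_1,\dots,r_m)^\top:\mathbb R^n\to\mathbb R^m$ is a residual map with Jacobian $J(\mathbf x)\in\mathbb R^{m\times n}$, $F(\mathbf x)=\frac12\|\mathbf R(\mathbf x)\|^2$, and $\mathbf g(\mathbf x)=J(\mathbf x)^\top\mathbf R(\mathbf x)$ is its gradient; a stationary point of $F$ is a point where $\mathbf g=0$. Block structure. A partition $I_1,\dots,I_K$ of the variable indices $\{1,\dots,n\}$ is given. $E_s$ is the set of $j$ such that $r_j$ depends only on variables in $I_s$, and $\widehat E=\{1,\dots,m\}\setminus\bigcup_{s}E_s$. Variables and residuals are ordered accordingly: $\mathbf x=(\mathbf x_1,\dots,\mathbf x_K)$, $\mathbf x_s\in\mathbb R^{n_s}$, $\mathbf R(\mathbf x)=(\mathbf R_1(\mathbf x_1),\dots,\mathbf R_K(\mathbf x_K),\rho(\mathbf x))$ with $\mathbf R_s=(r_j)_{j\in E_s}$ and $\rho=(r_j)_{j\in\widehat E}$. With $J_{s\mathbf R_s}=\partial\mathbf R_s/\partial\mathbf x_s$ and $J_{s\rho}=\partial\rho/\partial\mathbf x_s$, let $P(\mathbf x)$ be the block diagonal matrix with diagonal blocks $P_s=J_{s\mathbf R_s}^\top J_{s\mathbf R_s}+J_{s\rho}^\top J_{s\rho}$, and $B(\mathbf x)$ the block matrix with zero diagonal blocks and off-diagonal blocks $B_{ij}=J_{i\rho}^\top J_{j\rho}$ ($i\ne j$). Thus $J(\mathbf x)^\top J(\mathbf x)=P(\mathbf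 x)+B(\mathbf x)$. A superscript $k$ denotes evaluation at $\mathbf x^k$ ($J^k$, $\mathbf g^k$, $P^k$, $B^k$). Algorithm PILM. Parameters: $c>0$, integers $\ell_k\ge1$, numbers $\varepsilon_k>0$, damping parameters $\mu_k>0$. At iteration $k\ge0$: set $\mathbf y^1=-(P^k+\mu_kI)^{-1}\mathbf g^k$ and $\mathbf y^{l+1}=-(P^k+\mu_kI)^{-1}(\mathbf g^k+B^k\mathbf y^l)$ for $l=1,\dots,\ell_k-1$; set $\mathbf d^k=\mathbf y^{\ell_k}$; let $\alpha_k$ be the largest element of $\{2^{-j}\}_{j=0}^\infty$ such that $F(\mathbf x^k+\alpha_k\mathbf d^k)\le F(\mathbf x^k)-c\alpha_k^2\|\mathbf g^k\|^2+\varepsilon_k$; set $\mathbf x^{k+1}=\mathbf x^k+\alpha_k\mathbf d^k$. *)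

(* Defs.v *)
From HB Require Import structures.
From mathcomp Require Import all_boot all_order all_algebra.
From mathcomp Require Import all_classical all_reals all_analysis.
Set Implicit Arguments.
Unset Strict Implicit.
Unset Printing Implicit Defensive.
Import Order.TTheory GRing.Theory Num.Theory.
Import numFieldNormedType.Exports.
Local Open Scope classical_set_scope.
Local Open Scope ring_scope.

(* The canonical norm instance on matrices is the max norm;
   it induces the same topology and the same notion of differentiability, but
   every quantitative norm below has to be the Euclidean / spectral one. *)
Definition enorm (R : realType) (n : nat) (v : 'cV[R]_n) : R :=
  Num.sqrt (\sum_(i < n) v i ord0 ^+ 2).

(* The unit ball, rather than the unit sphere, keeps the set nonempty for
   n = 0. *)
Definition specnorm (R : realType) (m n : nat) (A : 'M[R]_(m, n)) : R :=
  sup [set enorm (A *m v) | v in [set v : 'cV[R]_n | enorm v <= 1]].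

(* Partial derivatives: column j is the derivative of f along the j-th
   canonical basis vector. The library's 'J is for row vectors and is the
   transpose of this matrix. *)
Definition jac (R : realType) (m n : nat) (f : 'cV[R]_n -> 'cV[R]_m)
    (x : 'cV[R]_n) : 'M[R]_(m, n) :=
  \matrix_(i < m, j < n) ('D_(delta_mx j ord0) f x) i ord0.

Definition C1 (R : realType) (m n : nat) (f : 'cV[R]_n -> 'cV[R]_m) : Prop :=
  (forall x, differentiable f x) /\ continuous (jac f).

Definition objective (R : realType) (m n : nat) (f : 'cV[R]_n -> 'cV[R]_m)
    (x : 'cV[R]_n) : R :=
  2^-1 * enorm (f x) ^+ 2.

Definition grad (R : realType) (m n : nat) (f : 'cV[R]_n -> 'cV[R]_m)
    (x : 'cV[R]_n) : 'cV[R]_n :=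
  (jac f x)^T *m f x.

Definition stationary (R : realType) (m n : nat) (f : 'cV[R]_n -> 'cV[R]_m)
    (x : 'cV[R]_n) : Prop :=
  grad f x = 0.

(* Indexed partition into nonempty, pairwise disjoint blocks. *)
Definition index_partition (n K : nat) (I : 'I_K -> {set 'I_n}) : Prop :=
  injective I /\ finset.partition [set I s | s : 'I_K]%SET [set: 'I_n]%SET.

Definition own_res (R : realType) (m n K : nat) (I : 'I_K -> {set 'I_n})
    (f : 'cV[R]_n -> 'cV[R]_m) (s : 'I_K) : {set 'I_m} :=
  [set j | `[< forall x y : 'cV[R]_n,
     (forall i, i \in I s -> x i ord0 = y i ord0) ->
     f x j ord0 = f y j ord0 >]]%SET.

Definition shared_res (R : realType) (m n K : nat) (I : 'I_K -> {set 'I_n})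
    (f : 'cV[R]_n -> 'cV[R]_m) : {set 'I_m} :=
  (~: \bigcup_(s < K) own_res I f s)%SET.

(* Blocks are not extracted but kept in place, padded with zeros, so that no
   reordering of variables and residuals is needed: for blocks M and N on the
   same rows, M^T *m N is then the corresponding block of an n x n matrix. *)
Definition mxrestrict (R : realType) (m n : nat) (E : {set 'I_m})
    (C : {set 'I_n}) (M : 'M[R]_(m, n)) : 'M[R]_(m, n) :=
  \matrix_(i < m, j < n) if (i \in E) && (j \in C) then M i j else 0.

Definition jac_own (R : realType) (m n K : nat) (I : 'I_K -> {set 'I_n})
    (f : 'cV[R]_n -> 'cV[R]_m) (s : 'I_K) (x : 'cV[R]_n) : 'M[R]_(m, n) :=
  mxrestrict (own_res I f s) (I s) (jac f x).

Definition jac_shared (R : realType) (m n K : nat) (I : 'I_K -> {set 'I_n})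
    (f : 'cV[R]_n -> 'cV[R]_m) (s : 'I_K) (x : 'cV[R]_n) : 'M[R]_(m, n) :=
  mxrestrict (shared_res I f) (I s) (jac f x).

Definition Pmx (R : realType) (m n K : nat) (I : 'I_K -> {set 'I_n})
    (f : 'cV[R]_n -> 'cV[R]_m) (x : 'cV[R]_n) : 'M[R]_n :=
  \sum_(s < K) ((jac_own I f s x)^T *m jac_own I f s x
              + (jac_shared I f s x)^T *m jac_shared I f s x).

Definition Bmx (R : realType) (m n K : nat) (I : 'I_K -> {set 'I_n})
    (f : 'cV[R]_n -> 'cV[R]_m) (x : 'cV[R]_n) : 'M[R]_n :=
  \sum_(s < K) \sum_(t < K | t != s)
    (jac_shared I f s x)^T *m jac_shared I f t x.

(* [inner_iterate I f mu x p] is y^(p+1); the iteration starts at y^1. *)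
Definition inner_iterate (R : realType) (m n K : nat) (I : 'I_K -> {set 'I_n})
    (f : 'cV[R]_n -> 'cV[R]_m) (mu : R) (x : 'cV[R]_n) (p : nat) : 'cV[R]_n :=
  let Q := invmx (Pmx I f x + mu%:M) in
  iter p (fun y => - (Q *m (grad f x + Bmx I f x *m y))) (- (Q *m grad f x)).

Definition direction (R : realType) (m n K : nat) (I : 'I_K -> {set 'I_n})
    (f : 'cV[R]_n -> 'cV[R]_m) (l : nat) (mu : R) (x : 'cV[R]_n) : 'cV[R]_n :=
  inner_iterate I f mu x l.-1.

Definition acceptable (R : realType) (m n : nat) (f : 'cV[R]_n -> 'cV[R]_m)
    (c eps : R) (x d : 'cV[R]_n) (a : R) : Prop :=
  objective f (x + a *: d)
    <= objective f x - c * a ^+ 2 * enorm (grad f x) ^+ 2 + eps.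

Definition line_search_step (R : realType) (m n : nat)
    (f : 'cV[R]_n -> 'cV[R]_m) (c eps : R) (x d : 'cV[R]_n) (a : R) : Prop :=
  [/\ exists j : nat, a = 2 ^- j,
      acceptable f c eps x d a
    & forall j : nat, acceptable f c eps x d (2 ^- j) -> 2 ^- j <= a].

Definition pilm_sequence (R : realType) (m n K : nat) (I : 'I_K -> {set 'I_n})
    (f : 'cV[R]_n -> 'cV[R]_m) (c : R) (l : nat -> nat) (eps mu : nat -> R)
    (x : nat -> 'cV[R]_n) : Prop :=
  forall k, let d := direction I f (l k) (mu k) (x k) in
    exists2 a : R, line_search_step f c (eps k) (x k) d a
                 & x k.+1 = x k + a *: d.

(* Main.v *)
(* With A = P + mu I and T = - A^-1 B, the inner iteration is a truncated Neumann
   series, d = sum_(i < l) T^i y1 with y1 = - A^-1 g. The operator T is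
   self-adjoint for the inner product induced by A and |u^T B u| <= q u^T A u
   with q = 1 / Cmu < 1, hence - g^T d >= (1 - q) y1^T A y1 whatever the number
   of inner steps (so lbar = 0 works), while |d| <= |g| / (mumin (1 - q)).
   Summing the line-search inequalities gives a_k |g_k| -> 0; near a
   nonstationary cluster point the steps a_k would be arbitrarily small, but
   there the mean value theorem makes the line search accept 2 a_k. *)

Require Import Defs.
From HB Require Import structures.
From mathcomp Require Import all_boot all_order all_algebra.
From mathcomp Require Import all_classical all_reals all_analysis.
From mathcomp Require Import ring lra.
Set Implicit Arguments.
Unset Strict Implicit.
Unset Printing Implicit Defensive.
Import Order.TTheory GRing.Theory Num.Theory.
Import numFieldNormedType.Exports.
Local Open Scope classical_set_scope.
Local Open Scope ring_scope.

(** * Euclidean inner product and norm *)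

Definition edot (R : realType) (n : nat) (u v : 'cV[R]_n) : R :=
  \sum_(i < n) u i ord0 * v i ord0.

(** The Frobenius norm: it dominates the spectral norm and is continuous by inspection of the
    entries, so it supplies the bounds that must hold uniformly near a point. *)
Definition frob (R : realType) (m n : nat) (A : 'M[R]_(m, n)) : R :=
  Num.sqrt (\sum_(i < m) \sum_(j < n) A i j ^+ 2).

Section EuclideanNorm.
Variables (R : realType) (n : nat).
Implicit Types (u v w : 'cV[R]_n) (a : R).

Lemma edotC u v : edot u v = edot v u.
Proof. by apply: eq_bigr => i _; rewrite mulrC. Qed.

Lemma edotDr u v w : edot u (v + w) = edot u v + edot u w.
Proof. by rewrite /edot -big_split; apply: eq_bigr => i _; rewrite mxE mulrDr. Qed.

Lemma edotNr u v : edot u (- v) = - edot u v.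
Proof. by rewrite /edot -sumrN; apply: eq_bigr => i _; rewrite mxE mulrN. Qed.

Lemma edotZr a u v : edot u (a *: v) = a * edot u v.
Proof.
by rewrite /edot big_distrr; apply: eq_bigr => i _; rewrite mxE /= mulrCA.
Qed.

Lemma edotDl u v w : edot (u + v) w = edot u w + edot v w.
Proof. by rewrite edotC edotDr !(edotC w). Qed.

Lemma edotNl u v : edot (- u) v = - edot u v.
Proof. by rewrite edotC edotNr edotC. Qed.

Lemma edotZl a u v : edot (a *: u) v = a * edot u v.
Proof. by rewrite edotC edotZr edotC. Qed.

Lemma edot_sumr (T : finType) (F : T -> 'cV[R]_n) u :
  edot u (\sum_i F i) = \sum_i edot u (F i).
Proof.
elim/big_ind2: _ => [|x1 x2 y1 y2 <- <-|//]; last by rewrite edotDr.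
by rewrite -(scale0r 0) edotZr mul0r.
Qed.

Lemma edot_ge0 u : 0 <= edot u u.
Proof. by apply: sumr_ge0 => i _; rewrite -expr2 sqr_ge0. Qed.

Lemma edot_eq0 u : edot u u = 0 -> u = 0.
Proof.
move=> /eqP; rewrite psumr_eq0 => [/allP u0|i _]; last by rewrite -expr2 sqr_ge0.
apply/colP => i; rewrite mxE; apply/eqP.
by have := u0 i (mem_index_enum i); rewrite -expr2 sqrf_eq0.
Qed.

Lemma enormE u : enorm u = Num.sqrt (edot u u).
Proof. by congr Num.sqrt; apply: eq_bigr => i _; rewrite expr2. Qed.

Lemma enorm_ge0 u : 0 <= enorm u.
Proof. exact: sqrtr_ge0. Qed.

Lemma enorm_sqr u : enorm u ^+ 2 = edot u u.
Proof. by rewrite enormE sqr_sqrtr ?edot_ge0. Qed.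

Lemma enorm0 : enorm (0 : 'cV[R]_n) = 0.
Proof.
by rewrite /enorm big1 ?sqrtr0 // => i _; rewrite mxE expr0n.
Qed.

Lemma enorm_eq0 u : enorm u = 0 -> u = 0.
Proof. by move=> u0; apply: edot_eq0; rewrite -enorm_sqr u0 expr0n. Qed.

Lemma enormZ a u : enorm (a *: u) = `|a| * enorm u.
Proof.
by rewrite !enormE edotZl edotZr mulrA -expr2 sqrtrM ?sqr_ge0 // sqrtr_sqr.
Qed.

Lemma enormN u : enorm (- u) = enorm u.
Proof. by rewrite !enormE edotNl edotNr opprK. Qed.

Lemma cauchy_schwarz u v : `|edot u v| <= enorm u * enorm v.
Proof.
rewrite -ler_sqr ?nnegrE ?mulr_ge0 ?enorm_ge0 // exprMn !enorm_sqr.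
rewrite real_normK ?num_real //.
have [/edot_eq0->|v0] := eqVneq (edot v v) 0.
  by rewrite -(scale0r 0) !edotZr !mul0r mulr0 expr0n.
have vp : 0 < edot v v by rewrite lt_def v0 edot_ge0.
(* This square expands to [edot v v] times the Cauchy-Schwarz gap [a * c - b ^+ 2]; clearing the
   denominator of the projection avoids any division. *)
have := edot_ge0 (edot v v *: u - edot u v *: v).
rewrite !(edotDl, edotDr, edotNl, edotNr, edotZl, edotZr) (edotC v u).
set a := edot u u; set b := edot u v; set c := edot v v => h.
rewrite -subr_ge0 -(pmulr_rge0 _ vp); apply: le_trans h _; rewrite -/c.
by rewrite le_eqVlt; apply/orP; left; apply/eqP; ring.
Qed.

Lemma enormD u v : enorm (u + v) <= enorm u + enorm v.
Proof.
rewrite -ler_sqr ?nnegrE ?addr_ge0 ?enorm_ge0 // enorm_sqr sqrrD !enorm_sqr.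
rewrite !(edotDl, edotDr) (edotC v u).
have := le_trans (ler_norm _) (cauchy_schwarz u v); lra.
Qed.

End EuclideanNorm.

(** * Spectral and Frobenius norms as operator bounds *)

Section MatrixNorms.
Variables (R : realType) (m n : nat).
Implicit Types (A : 'M[R]_(m, n)).

Lemma edot_mulmx A (u : 'cV[R]_n) (v : 'cV[R]_m) :
  edot (A *m u) v = edot u (A^T *m v).
Proof.
rewrite /edot.
under eq_bigr do rewrite mxE big_distrl /=.
rewrite exchange_big; apply: eq_bigr => j _.
rewrite mxE big_distrr; apply: eq_bigr => i _.
by rewrite mxE /= mulrCA mulrA.
Qed.

Lemma frob_ge0 A : 0 <= frob A.
Proof. exact: sqrtr_ge0. Qed.

(** Cauchy-Schwarz applied to each row, then summed over the rows. *)
Lemma enorm_mulmx_frob A (v : 'cV[R]_n) : enorm (A *m v) <= frob A * enorm v.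
Proof.
have A0 : 0 <= \sum_(i < m) \sum_(j < n) A i j ^+ 2.
  by apply: sumr_ge0 => i _; apply: sumr_ge0 => j _; rewrite sqr_ge0.
rewrite -ler_sqr ?nnegrE ?mulr_ge0 ?enorm_ge0 ?frob_ge0 //.
rewrite exprMn enorm_sqr /frob sqr_sqrtr // big_distrl.
apply: ler_sum => i _ /=; rewrite -expr2.
have -> : (A *m v) i ord0 = edot (row i A)^T v.
  by rewrite mxE; apply: eq_bigr => j _; rewrite !mxE.
have -> : \sum_(j < n) A i j ^+ 2 = enorm (row i A)^T ^+ 2.
  by rewrite enorm_sqr; apply: eq_bigr => j _; rewrite !mxE expr2.
rewrite -exprMn -[leLHS]real_normK ?num_real // ler_sqr ?nnegrE //.
  exact: cauchy_schwarz.
by rewrite mulr_ge0 ?enorm_ge0.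
Qed.

Let image_ub A :
  ubound [set enorm (A *m v) | v in [set v : 'cV[R]_n | enorm v <= 1]] (frob A).
Proof.
move=> _ [v /= v1 <-]; apply: le_trans (enorm_mulmx_frob A v) _.
by rewrite ler_piMr ?frob_ge0.
Qed.

(** [sup] has its intended meaning only on a nonempty bounded set; the zero vector and the Frobenius
    bound ensure both. *)
Let image_sup A :
  has_sup [set enorm (A *m v) | v in [set v : 'cV[R]_n | enorm v <= 1]].
Proof.
split; last by exists (frob A).
by exists (enorm (A *m 0)), 0; rewrite //= enorm0.
Qed.

Lemma specnorm_le_frob A : specnorm A <= frob A.
Proof. by apply: ge_sup; [case: (image_sup A) | exact: image_ub]. Qed.

Lemma enorm_mulmx A (v : 'cV[R]_n) : enorm (A *m v) <= specnorm A * enorm v.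
Proof.
have [v0|v0] := eqVneq (enorm v) 0.
  by rewrite (enorm_eq0 v0) mulmx0 !enorm0 mulr0.
have vp : 0 < enorm v by rewrite lt_def v0 enorm_ge0.
rewrite -ler_pdivrMr //; apply: ub_le_sup; first by case: (image_sup A).
exists ((enorm v)^-1 *: v) => /=.
  by rewrite enormZ ger0_norm ?invr_ge0 ?enorm_ge0 // mulVf.
by rewrite -scalemxAr enormZ ger0_norm ?invr_ge0 ?enorm_ge0 // mulrC.
Qed.

End MatrixNorms.

(** * The inner iteration for a coercive symmetric [A] and a relatively small symmetric [B] *)

Section InnerIteration.
Variables (R : realType) (n : nat) (A B : 'M[R]_n) (mu q : R) (g : 'cV[R]_n).
Hypotheses (mu_gt0 : 0 < mu) (q_ge0 : 0 <= q) (q_lt1 : q < 1).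
Hypotheses (A_sym : A^T = A) (B_sym : B^T = B).
Hypothesis A_coercive : forall u, mu * enorm u ^+ 2 <= edot u (A *m u).
Hypothesis B_le : specnorm B <= q * mu.

Local Notation Q := (invmx A).
Local Notation y1 := (- (Q *m g)).
Local Notation y p := (iter p (fun y => - (Q *m (g + B *m y))) y1).
Let T (u : 'cV[R]_n) := - (Q *m (B *m u)).

Lemma coercive_enorm u : mu * enorm u <= enorm (A *m u).
Proof.
have [->|u0] := eqVneq (enorm u) 0; first by rewrite mulr0 enorm_ge0.
have up : 0 < enorm u by rewrite lt_def u0 enorm_ge0.
rewrite -(ler_pM2r up) -mulrA -expr2; apply: le_trans (A_coercive u) _.
apply: le_trans (ler_norm _) _; rewrite mulrC; exact: cauchy_schwarz.
Qed.

(** By symmetry a row of the left kernel is a vector killed by [A], and coercivity makes it zero.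
    This matters because [invmx] returns its argument on a singular matrix. *)
Lemma coercive_unitmx : A \in unitmx.
Proof.
rewrite -row_full_unit -[row_full _]/(\rank A == n) -mxrank_tr -/(row_free _).
rewrite A_sym -kermx_eq0; apply/eqP/row_matrixP => i; rewrite row0.
have : row i (kermx A) *m A = 0 by rewrite -row_mul mulmx_ker row0.
move/(congr1 trmx); rewrite trmx_mul A_sym trmx0 => Au.
have := coercive_enorm (row i (kermx A))^T; rewrite Au enorm0.
rewrite pmulr_rle0 // => un.
apply: trmx_inj; rewrite trmx0; apply: enorm_eq0; apply/eqP.
by rewrite eq_le un enorm_ge0.
Qed.

Lemma enorm_invmx u : enorm (Q *m u) <= enorm u / mu.
Proof.
rewrite ler_pdivlMr // mulrC; apply: le_trans (coercive_enorm _) _.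
by rewrite mulmxA mulmxV ?coercive_unitmx // mul1mx.
Qed.

Let energy u := edot (A *m u) u.

Let energy_ge0 u : 0 <= energy u.
Proof.
by rewrite /energy edotC (le_trans _ (A_coercive u)) // mulr_ge0 ?sqr_ge0 ?ltW.
Qed.

Let mulmxT u : A *m T u = - (B *m u).
Proof. by rewrite mulmxN mulmxA mulmxV ?coercive_unitmx // mul1mx. Qed.

(** [A *m T u] is [- (B *m u)], so symmetry of [B] gives self-adjointness for the inner product of
    [A]. *)
Let T_selfadjoint u v : edot (A *m T u) v = edot (A *m u) (T v).
Proof.
rewrite [RHS]edot_mulmx A_sym !mulmxT edotNl edotNr edot_mulmx B_sym.
by [].
Qed.

Let iterT_selfadjoint i u v :
  edot (A *m iter i T u) v = edot (A *m u) (iter i T v).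
Proof.
elim: i u v => // i IHi u v.
by rewrite iterS T_selfadjoint IHi -iterSr.
Qed.

(** The chain is |u^T B u| <= |B| |u|^2 <= q mu |u|^2 <= q u^T A u, the last step by coercivity. *)
Let T_contracts_energy u : - (q * energy u) <= edot (A *m u) (T u).
Proof.
rewrite -T_selfadjoint mulmxT edotNl lerN2.
apply: le_trans (ler_norm _) _; apply: le_trans (cauchy_schwarz _ _) _.
have B1 : enorm (B *m u) <= q * mu * enorm u.
  apply: le_trans (enorm_mulmx _ _) _; exact: ler_wpM2r (enorm_ge0 _) _ _ B_le.
apply: le_trans (ler_wpM2r (enorm_ge0 u) B1) _.
rewrite -!mulrA ler_wpM2l // -expr2 /energy edotC; exact: A_coercive.
Qed.

(** Unrolling y -> y1 + T y shows that [y p] is the Neumann partial sum of the powers of [T] from 0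
    to [p]. *)
Let y_step p : y p.+1 = y p + iter p.+1 T y1.
Proof.
have S i : y i.+1 = y1 + T (y i) by rewrite /= mulmxDr opprD.
elim: p => [|p IHp]; first exact: S.
rewrite S [in LHS]IHp [in RHS]S -addrA; congr (_ + _).
by rewrite [in RHS]iterS /T !mulmxDr opprD.
Qed.

(* Consecutive powers T^(2i), T^(2i+1) of the self-adjoint contraction T pair
   up to a nonnegative quadratic form, so no lower bound on the number of
   inner steps is needed. *)
Lemma inner_descent p : (1 - q) * edot (A *m y1) y1 <= - edot g (y p).
Proof.
rewrite -/(energy y1).
(* Since A y1 = - g, the descent becomes an inner product induced by [A]. *)
have -> : - edot g (y p) = edot (A *m y1) (y p).
  by rewrite mulmxN mulmxA mulmxV ?coercive_unitmx // mul1mx edotNl.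
pose e i := edot (A *m y1) (iter i T y1).
(* Half of the powers of [T] are moved to the left argument by self-adjointness, so even terms are
   energies and odd terms are controlled by the same energies. *)
have e_even i : e i.*2 = energy (iter i T y1).
  by rewrite /energy iterT_selfadjoint -iterD addnn.
have e_odd i : - (q * energy (iter i T y1)) <= e i.*2.+1.
  rewrite /e -addnn -addnS iterD -iterT_selfadjoint iterS.
  exact: T_contracts_energy.
pose s p := edot (A *m y1) (y p).
have s_step i : s i.+1 = s i + e i.+1 by rewrite /s y_step edotDr.
have pair_ge (a b : R) : - (q * a) <= b -> (1 - q) * a <= a + b.
  by move=> ?; lra.
(* A sum ending at an odd index consists of complete pairs: the first gives the bound, the others
   are nonnegative. *)
have odd_case i : (1 - q) * energy y1 <= s i.*2.+1.
  elim: i => [|i IHi].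
    have := e_odd 0; rewrite s_step double0 /s /= -/(energy y1).
    exact: pair_ge.
  rewrite doubleS s_step s_step -doubleS e_even.
  have := e_odd i.+1; have := energy_ge0 (iter i.+1 T y1).
  move=> a0 /pair_ge ab; rewrite -addrA (le_trans IHi) // lerDl (le_trans _ ab) //.
  by rewrite mulr_ge0 // subr_ge0 ltW.
rewrite -/(s p) -(odd_double_half p); case: (odd p) => /=.
  by rewrite add1n.
(* At index 0 the sum is the energy of y1 itself; a later even index adds one nonnegative energy to
   an odd-index sum. *)
rewrite add0n; case: p./2 => [|i].
  rewrite /s /= -/(energy y1).
  by rewrite ler_piMl ?energy_ge0 // gerBl.
rewrite doubleS s_step -doubleS e_even.
by rewrite (le_trans (odd_case i)) // lerDl energy_ge0.
Qed.

(** [T] also shrinks the Euclidean norm by [q], because |Q| <= 1/mu and |B| <= q mu; the bound is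
    the fixed point of b -> |g|/mu + q b. *)
Lemma inner_bounded p : enorm (y p) <= enorm g / (mu * (1 - q)).
Proof.
have q1 : 0 < 1 - q by rewrite subr_gt0.
have T_le u : enorm (T u) <= q * enorm u.
  rewrite enormN; apply: le_trans (enorm_invmx _) _.
  rewrite ler_pdivrMr //; apply: le_trans (enorm_mulmx _ _) _.
  by rewrite mulrAC ler_wpM2r ?enorm_ge0.
rewrite invfM mulrA.
have g1 : 0 <= enorm g / mu by rewrite divr_ge0 ?enorm_ge0 ?ltW.
rewrite ler_pdivlMr //; elim: p => [|p IHp].
  rewrite /= enormN (le_trans _ (enorm_invmx g)) // ler_piMr ?enorm_ge0 //.
  by rewrite gerBl.
have -> : y p.+1 = y1 + T (y p) by rewrite /= mulmxDr opprD.
apply: (@le_trans _ _ ((enorm g / mu + q * enorm (y p)) * (1 - q))).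
  rewrite ler_wpM2r ?(ltW q1) // (le_trans (enormD _ _)) // lerD //.
  by rewrite enormN enorm_invmx.
rewrite mulrDl -[q * _ * _]mulrA (le_trans (lerD (lexx _) (ler_wpM2l q_ge0 IHp))) //.
by rewrite mulrBr mulr1 [q * _]mulrC subrK.
Qed.

(** From g = - A y1 one gets |g| <= C |y1|, and coercivity bounds the energy of y1 below by mu
    |y1|^2. *)
Lemma inner_energy_ge C : (forall u, enorm (A *m u) <= C * enorm u) -> 0 < C ->
  mu * (enorm g / C) ^+ 2 <= edot (A *m y1) y1.
Proof.
move=> AC C0; rewrite edotC; apply: le_trans (A_coercive _).
rewrite ler_wpM2l ?(ltW mu_gt0) // ler_sqr ?nnegrE ?divr_ge0 ?enorm_ge0 ?(ltW C0) //.
rewrite ler_pdivrMr // mulrC; apply: le_trans (AC _).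
by rewrite mulmxN mulmxA mulmxV ?coercive_unitmx // mul1mx enormN.
Qed.

End InnerIteration.

(** * Entrywise continuity of matrix-valued maps, and Euclidean neighbourhoods *)

Section MatrixContinuity.
Variables (R : realType) (T : topologicalType).

Definition mxcontinuous (m n : nat) (M : T -> 'M[R]_(m, n)) : Prop :=
  forall i j, continuous (fun x => M x i j).

Lemma continuous_sumr (J : Type) (r : seq J) (P : pred J) (F : J -> T -> R) :
  (forall i, P i -> continuous (F i)) ->
  continuous (fun x => \sum_(i <- r | P i) F i x).
Proof. by move=> cF; apply: continuous_big => //; exact: add_continuous. Qed.

Lemma mxcontinuous_sum (J : Type) (r : seq J) (P : pred J) (m n : nat)
    (F : J -> T -> 'M[R]_(m, n)) :
  (forall i, P i -> mxcontinuous (F i)) ->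
  mxcontinuous (fun x => \sum_(i <- r | P i) F i x).
Proof.
move=> cF i j; under eq_fun do rewrite summxE.
by apply: continuous_sumr => k /cF.
Qed.

Lemma mxcontinuousD (m n : nat) (M N : T -> 'M[R]_(m, n)) :
  mxcontinuous M -> mxcontinuous N -> mxcontinuous (fun x => M x + N x).
Proof.
move=> cM cN i j; under eq_fun do rewrite mxE.
by move=> x; apply: cvgD; [exact: cM | exact: cN].
Qed.

Lemma mxcontinuousB_cst (m n : nat) (M : T -> 'M[R]_(m, n)) (N : 'M[R]_(m, n)) :
  mxcontinuous M -> mxcontinuous (fun x => M x - N).
Proof.
move=> cM i j; under eq_fun do rewrite !mxE.
by move=> x; apply: cvgB; [exact: cM | exact: cvg_cst].
Qed.

Lemma mxcontinuous_mulmx (m n p : nat) (M : T -> 'M[R]_(m, n))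
    (N : T -> 'M[R]_(n, p)) :
  mxcontinuous M -> mxcontinuous N -> mxcontinuous (fun x => M x *m N x).
Proof.
move=> cM cN i j; under eq_fun do rewrite mxE.
by apply: continuous_sumr => k _ x; apply: cvgM; [exact: cM | exact: cN].
Qed.

Lemma mxcontinuous_trmx (m n : nat) (M : T -> 'M[R]_(m, n)) :
  mxcontinuous M -> mxcontinuous (fun x => (M x)^T).
Proof. by move=> cM i j; under eq_fun do rewrite mxE; exact: cM. Qed.

Lemma mxcontinuous_mxrestrict (m n : nat) (E : {set 'I_m}) (C : {set 'I_n})
    (M : T -> 'M[R]_(m, n)) :
  mxcontinuous M -> mxcontinuous (fun x => mxrestrict E C (M x)).
Proof.
move=> cM i j; under eq_fun do rewrite mxE.
by case: (_ && _); [exact: cM | exact: cst_continuous].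
Qed.

Lemma mxcontinuous_coord (m n : nat) (M : T -> 'M[R]_(m, n)) :
  continuous M -> mxcontinuous M.
Proof.
move=> cM i j x; apply: (@continuous_comp _ _ _ M (fun N => N i j)).
  exact: cM.
exact: coord_continuous.
Qed.

Lemma continuous_frob (m n : nat) (M : T -> 'M[R]_(m, n)) :
  mxcontinuous M -> continuous (fun x => frob (M x)).
Proof.
move=> cM x; apply: (@continuous_comp _ _ _
  (fun x => \sum_i \sum_j M x i j ^+ 2)); last exact: sqrt_continuous.
move: x; apply: continuous_sumr => i _; apply: continuous_sumr => j _ x.
by apply: (@cvgM _ _ _ _ (fun z => M z i j) (fun z => M z i j)); exact: cM.
Qed.

Lemma continuous_enorm (n : nat) (v : T -> 'cV[R]_n) :
  mxcontinuous v -> continuous (fun x => enorm (v x)).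
Proof.
move=> cv x; apply: (@continuous_comp _ _ _
  (fun x => \sum_i v x i ord0 ^+ 2)); last exact: sqrt_continuous.
move: x; apply: continuous_sumr => i _ x.
by apply: (@cvgM _ _ _ _ (fun z => v z i ord0) (fun z => v z i ord0)); exact: cv.
Qed.

End MatrixContinuity.

Lemma nbhs_enorm (R : realType) (n : nat) (x : 'cV[R]_n) (r : R) :
  0 < r -> nbhs x [set z | enorm (z - x) < r].
Proof.
move=> r0; have : continuous (fun z : 'cV[R]_n => enorm (z - x)).
  by apply/continuous_enorm/mxcontinuousB_cst/mxcontinuous_coord => z; exact: cvg_id.
by move=> /(_ x)/cvgr_lt; apply; rewrite subrr enorm0.
Qed.

(** The ambient topology comes from the max norm, which is attained at one entry and hence is at
    most the Euclidean norm. *)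
Lemma nbhs_enormP (R : realType) (n : nat) (x : 'cV[R]_n)
    (A : set 'cV[R]_n) : nbhs x A ->
  exists2 r : R, 0 < r & forall z, enorm (z - x) < r -> A z.
Proof.
move=> /nbhs_normP[r /= r0 rA]; exists r => // z zr; apply: rA => /=.
rewrite distrC; apply: le_lt_trans zr.
have [->|] := eqVneq `|z - x| 0; first exact: enorm_ge0.
move=> /mx_norm_neq0[[i j]] /= zE.
have -> : `|z - x| = `|(z - x) i j| by [].
rewrite ord1 -sqrtr_sqr ler_wsqrtr // (bigD1 i) //= lerDl.
by apply: sumr_ge0 => k _; rewrite sqr_ge0.
Qed.

(** * Derivative and mean value formula of the objective along a line *)

Section LeastSquares.
Variables (R : realType) (m n : nat) (f : 'cV[R]_n -> 'cV[R]_m).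

Lemma diff_jac x v : differentiable f x -> 'd f x v = jac f x *m v.
Proof.
move=> df; rewrite {1}[v]matrix_sum_delta.
rewrite (eq_bigr (fun j => v j ord0 *: delta_mx j ord0)) => [|j _]; last first.
  by rewrite big_ord_recl big_ord0 addr0.
rewrite linear_sum; apply/colP => i; rewrite summxE [RHS]mxE.
by apply: eq_bigr => j _; rewrite linearZ /= !mxE -deriveE // mulrC.
Qed.

Lemma objectiveE x : objective f x = 2^-1 * edot (f x) (f x).
Proof. by rewrite /objective enorm_sqr. Qed.

Lemma objective_ge0 x : 0 <= objective f x.
Proof. by rewrite mulr_ge0 ?sqr_ge0 // invr_ge0. Qed.

Hypothesis df : forall x : 'cV[R]_n, differentiable f x.

Lemma is_derive_line (x d : 'cV[R]_n) (s : R) (i : 'I_m) :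
  is_derive s (1 : R) (fun t : R => f (x + t *: d) i ord0)
    ((jac f (x + s *: d) *m d) i ord0).
Proof.
have dline : is_diff s (fun t : R => x + t *: d) (fun t => t *: d).
  have := is_diffD (is_diff_cst x s) (is_diff_scalel s d).
  by congr is_diff_def; apply/funext => t; rewrite ?add0r.
have dfl := is_diff_comp dline (differentiableP (df (x + s *: d))).
(* The coordinate projection is packaged as a linear map, so that, being continuous, it is its own
   differential. *)
have dc : is_diff (f (x + s *: d)) (fun N : 'cV[R]_m => N i ord0 : R)
    (fun N => N i ord0).
  have dN N : is_diff N (fun N : 'cV[R]_m => N i ord0 : R) (fun N => N i ord0).
    have @c : {linear 'cV[R]_m -> R}.
      by exists (fun N : 'cV[R]_m => N i ord0); do 2![eexists];
        do ?[constructor]; rewrite ?mxE // => ? *; rewrite ?mxE //; move=> ?;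
        rewrite !mxE.
    rewrite (_ : (fun _ => _) = c) //.
    apply: DiffDef; first exact/linear_differentiable/coord_continuous.
    by apply: diff_lin; exact: coord_continuous.
  exact: dN.
have dt := is_diff_comp dfl dc.
apply: DeriveDef; first by apply: diff_derivable; case: dt.
rewrite deriveE; last by case: dt.
by rewrite diff_val /= scale1r diff_jac.
Qed.

Lemma is_derive_objective (x d : 'cV[R]_n) (s : R) :
  is_derive s (1 : R) (fun t : R => objective f (x + t *: d))
    (edot (grad f (x + s *: d)) d).
Proof.
have dl := is_derive_line x d s.
have := is_deriveZ 2^-1 (is_derive_sum (fun i => is_deriveM (dl i) (dl i))).
congr is_derive.
  by apply/funext => t; rewrite objectiveE /edot fct_sumE.
(* Moving the transposed Jacobian across the product leaves R^T J d; the factor 1/2 then cancels the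
   two equal terms of the product rule. *)
rewrite /grad edot_mulmx trmxK /edot.
rewrite scaler_sumr; apply: eq_bigr => i _.
rewrite -mulr2n -[LHS]/(2^-1 * (_ * _ *+ 2)) -[X in _ * X = _]mulr_natl.
by rewrite mulKf ?pnatr_eq0.
Qed.

Lemma objective_mean_value (x d : 'cV[R]_n) (t : R) : 0 < t ->
  exists2 s : R, 0 < s < t &
    objective f (x + t *: d) - objective f x
      = t * edot (grad f (x + s *: d)) d.
Proof.
move=> t0; have dF := is_derive_objective x d.
have [|s] := MVT t0 (fun s _ => dF s).
  apply: continuous_subspaceT => s; apply: differentiable_continuous.
  by apply/derivable1_diffP; case: (dF s).
rewrite in_itv /= => st; rewrite scale0r addr0 subr0 mulrC => eqF.
by exists s.
Qed.

End LeastSquares.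

(** * Symmetry, positivity and continuity of the block matrices *)

Section BlockMatrices.
Variables (R : realType) (m n K : nat) (I : 'I_K -> {set 'I_n}).
Variable f : 'cV[R]_n -> 'cV[R]_m.

Lemma trmx_Pmx x : (Pmx I f x)^T = Pmx I f x.
Proof.
rewrite /Pmx linear_sum; apply: eq_bigr => s _ /=.
by rewrite linearD /= !trmx_mul !trmxK.
Qed.

(** Transposition exchanges blocks (s, t) and (t, s), and the condition [t != s] is symmetric. *)
Lemma trmx_Bmx x : (Bmx I f x)^T = Bmx I f x.
Proof.
rewrite /Bmx linear_sum /=; under eq_bigr do rewrite linear_sum /=.
rewrite (exchange_big_dep predT) //=; apply: eq_bigr => s _.
by apply: eq_big => [t | t _]; rewrite ?trmx_mul ?trmxK // eq_sym.
Qed.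

Lemma Pmx_psd x u : 0 <= edot u (Pmx I f x *m u).
Proof.
rewrite mulmx_suml edot_sumr; apply: sumr_ge0 => s _.
rewrite mulmxDl edotDr -!mulmxA.
by rewrite addr_ge0 // -edot_mulmx edot_ge0.
Qed.

Hypothesis hf : C1 f.

Let continuous_jac : mxcontinuous (jac f).
Proof. by case: hf => _ /mxcontinuous_coord. Qed.

Lemma mxcontinuous_grad : mxcontinuous (grad f).
Proof.
apply: mxcontinuous_mulmx; first exact: mxcontinuous_trmx.
apply: mxcontinuous_coord => x; apply: differentiable_continuous.
by case: hf.
Qed.

Lemma mxcontinuous_Pmx : mxcontinuous (Pmx I f).
Proof.
apply: mxcontinuous_sum => s _; apply: mxcontinuousD.
  by apply: mxcontinuous_mulmx; rewrite ?/jac_own;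
    [apply: mxcontinuous_trmx|]; exact: mxcontinuous_mxrestrict.
by apply: mxcontinuous_mulmx; rewrite ?/jac_shared;
  [apply: mxcontinuous_trmx|]; exact: mxcontinuous_mxrestrict.
Qed.

Lemma mxcontinuous_Bmx : mxcontinuous (Bmx I f).
Proof.
apply: mxcontinuous_sum => s _; apply: mxcontinuous_sum => t _.
by apply: mxcontinuous_mulmx; [apply: mxcontinuous_trmx|];
  exact: mxcontinuous_mxrestrict.
Qed.

End BlockMatrices.

(** * Size and descent of the search direction under the damping rule *)

Section Direction.
Variables (R : realType) (m n K : nat) (I : 'I_K -> {set 'I_n}).
Variables (f : 'cV[R]_n -> 'cV[R]_m) (mumin Cmu mu : R) (x : 'cV[R]_n).
Hypotheses (mumin_gt0 : 0 < mumin) (Cmu_gt1 : 1 < Cmu).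
Hypothesis muE : mu = Num.max mumin (Cmu * specnorm (Bmx I f x)).

Let Cmu_gt0 : 0 < Cmu. Proof. exact: lt_trans Cmu_gt1. Qed.
Let mumin_le : mumin <= mu. Proof. by rewrite muE le_max lexx. Qed.
Let mu_gt0 : 0 < mu. Proof. exact: lt_le_trans mumin_le. Qed.
Let q_ge0 : 0 <= Cmu^-1. Proof. by rewrite invr_ge0 ltW. Qed.
Let q_lt1 : Cmu^-1 < 1. Proof. by rewrite invf_lt1. Qed.
Let q1_gt0 : 0 < 1 - Cmu^-1. Proof. by rewrite subr_gt0. Qed.

Let A := Pmx I f x + mu%:M.

Let A_sym : A^T = A.
Proof. by rewrite /A linearD /= trmx_Pmx tr_scalar_mx. Qed.

Let A_coercive u : mu * enorm u ^+ 2 <= edot u (A *m u).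
Proof.
by rewrite mulmxDl edotDr mul_scalar_mx edotZr enorm_sqr lerDr Pmx_psd.
Qed.

Let B_le : specnorm (Bmx I f x) <= Cmu^-1 * mu.
Proof. by rewrite ler_pdivlMl // muE le_max lexx orbT. Qed.

(** The maximum defining [mu] is at most the sum of its arguments, and the Frobenius norm replaces
    the spectral one so that the constant is continuous in [x]. *)
Let A_le u :
  enorm (A *m u) <= (frob (Pmx I f x) + mumin + Cmu * frob (Bmx I f x)) * enorm u.
Proof.
rewrite mulmxDl mul_scalar_mx (le_trans (enormD _ _)) //.
rewrite enormZ (gtr0_norm mu_gt0) -addrA mulrDl.
rewrite lerD ?enorm_mulmx_frob // ler_wpM2r ?enorm_ge0 // muE ge_max.
rewrite lerDl mulr_ge0 ?frob_ge0 ?(ltW Cmu_gt0) //=.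
apply: ler_wpDl; first exact: ltW.
by rewrite ler_pM2l // specnorm_le_frob.
Qed.

Lemma enorm_direction l : enorm (direction I f l mu x)
  <= enorm (grad f x) / (mumin * (1 - Cmu^-1)).
Proof.
apply: le_trans (inner_bounded _ mu_gt0 q_ge0 q_lt1 A_sym A_coercive B_le _) _.
rewrite ler_wpM2l ?enorm_ge0 // lef_pV2 ?posrE ?mulr_gt0 //.
by rewrite ler_pM2r.
Qed.

(** Any upper bound [C] is allowed, so one constant can serve a whole neighbourhood; the damping
    enters only through [mumin]. *)
Lemma direction_descent l C :
  frob (Pmx I f x) + mumin + Cmu * frob (Bmx I f x) <= C ->
  (1 - Cmu^-1) * (mumin * (enorm (grad f x) / C) ^+ 2)
    <= - edot (grad f x) (direction I f l mu x).
Proof.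
move=> leC.
have C0 : 0 < C.
  apply: lt_le_trans leC; apply: ltr_pwDl; last first.
    by rewrite mulr_ge0 ?frob_ge0 ?ltW.
  by rewrite ltr_wpDl ?frob_ge0.
apply: le_trans (inner_descent _ mu_gt0 q_ge0 q_lt1 A_sym (trmx_Bmx I f x)
  A_coercive B_le l.-1).
rewrite ler_pM2l //.
apply: le_trans (inner_energy_ge (grad f x) mu_gt0 A_sym A_coercive _ C0).
  by rewrite ler_wpM2r ?sqr_ge0.
by move=> u; apply: le_trans (A_le u) _; rewrite ler_wpM2r ?enorm_ge0.
Qed.

End Direction.

(** * Limits of the perturbed decrease and acceptance of small steps *)

(** [F k] minus the partial sum of [eps] is nonincreasing and bounded below by minus the total sum,
    so it converges and its successive differences vanish. *)
Lemma summable_perturbation_decrease (R : realType) (F eps : nat -> R) :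
  (forall k, 0 <= F k) -> (forall k, 0 < eps k) -> cvgn (series eps) ->
  (forall k, 0 <= F k + eps k - F k.+1) ->
  F k + eps k - F k.+1 @[k --> \oo] --> 0.
Proof.
move=> F0 e0 ce w0.
pose u k := F k - series eps k.
have uE k : u k - u k.+1 = F k + eps k - F k.+1.
  by rewrite /u seriesSr; ring.
have : cvgn u.
  apply: nonincreasing_is_cvgn.
    by apply/nonincreasing_seqP => k; rewrite -subr_ge0 uE.
  exists (- limn (series eps)) => _ [k _ <-]; rewrite /u.
  rewrite -[leLHS]add0r lerD // lerN2.
  apply: nondecreasing_cvgn_le => //.
  by apply: nondecreasing_series => i _ _; exact: ltW.
move=> cu; have : u k - u k.+1 @[k --> \oo] --> limn u - limn u.
  by apply: cvgB => //; rewrite (cvg_shiftS u).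
by rewrite subrr; under eq_fun do rewrite uE.
Qed.

Lemma cluster_seq (T : topologicalType) (u : nat -> T) (a : T) (V : set T) N :
  cluster (u @ \oo) a -> nbhs a V -> exists2 k, (N <= k)%N & V (u k).
Proof.
move=> cl aV.
have [|_ [[k Nk <-] Vk]] := cl [set u k | k in [set k | (N <= k)%N]] V _ aV.
  by exists N => // k /= Nk; exists k.
by exists k.
Qed.

(** By the mean value theorem the objective changes by at most t (e |d| - delta), and the smallness
    condition puts this below - c t^2 |g|^2. *)
Lemma acceptable_small_step (R : realType) (m n : nat)
    (f : 'cV[R]_n -> 'cV[R]_m) (c eps e delta t : R) (x d : 'cV[R]_n) :
  (forall z, differentiable f z) -> 0 < eps -> 0 < t ->
  (forall s, 0 < s < t -> enorm (grad f (x + s *: d) - grad f x) <= e) ->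
  delta <= - edot (grad f x) d ->
  e * enorm d + c * t * enorm (grad f x) ^+ 2 <= delta ->
  acceptable f c eps x d t.
Proof.
move=> df eps0 t0 grad_close descent small.
have [s st Fs] := objective_mean_value df x d t0.
have gs : edot (grad f (x + s *: d)) d <= e * enorm d - delta.
  rewrite -[grad f (x + _)](subrK (grad f x)) edotDl lerD //; last by rewrite lerNr.
  apply: le_trans (ler_norm _) _; apply: le_trans (cauchy_schwarz _ _) _.
  by rewrite ler_wpM2r ?enorm_ge0 // grad_close.
rewrite /acceptable -[leLHS](subrK (objective f x)) Fs.
apply: (@le_trans _ _ (t * (e * enorm d - delta) + objective f x)).
  by rewrite lerD2r ler_pM2l.
have key (D G F : R) : t * (e * D + c * t * G) <= t * delta ->
  t * (e * D - delta) + F <= F - c * t ^+ 2 * G + eps by move=> ?; nra.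
by apply: key; rewrite ler_pM2l.
Qed.

(** * Stationarity of accumulation points *)

Theorem theorem3p1 (R : realType) (m n K : nat) (I : 'I_K -> {set 'I_n})
    (f : 'cV[R]_n -> 'cV[R]_m) (L c mumin Cmu : R) (eps : nat -> R)
    (hI : index_partition I)
    (hf : C1 f)
    (hL : forall x y : 'cV[R]_n,
       specnorm (jac f x - jac f y) <= L * enorm (x - y))
    (hc : 0 < c)
    (heps : forall k, 0 < eps k)
    (heps_sum : cvgn (series eps))
    (hmumin : 0 < mumin)
    (hCmu : 1 < Cmu) :
  exists lbar : nat, forall ell : nat, (lbar <= ell)%N ->
    forall l : nat -> nat,
    (forall k, (1 <= l k)%N) -> (forall k, (ell <= l k)%N) ->
    forall (x0 : 'cV[R]_n) (mu : nat -> R) (x : nat -> 'cV[R]_n),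
    x 0%N = x0 ->
    (forall k, mu k = Num.max mumin (Cmu * specnorm (Bmx I f (x k)))) ->
    pilm_sequence I f c l eps mu x ->
    forall xstar : 'cV[R]_n, cluster (x @ \oo) xstar -> stationary f xstar.
Proof.
exists 0%N => ell _ l _ _ x0 mu x _ muE pilm xs clx.
rewrite /stationary; apply: contrapT => gs_neq0.
pose g := grad f; pose G := enorm (g xs).
have G_gt0 : 0 < G.
  by rewrite lt_def enorm_ge0 andbT; apply/eqP => /enorm_eq0.
have q1_gt0 : 0 < 1 - Cmu^-1.
  by rewrite subr_gt0 invf_lt1 // (lt_trans _ hCmu).
(* Close to [xs] the gradient norm will lie between G/2 and 2G: [D] bounds the direction there, [C]
   bounds the damped matrix with slack 1 in each Frobenius norm, and [delta] is the resulting
   guaranteed descent. *)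
pose D := 2 * G / (mumin * (1 - Cmu^-1)).
have D_gt0 : 0 < D by rewrite !(divr_gt0, mulr_gt0).
pose C := frob (Pmx I f xs) + 1 + mumin + Cmu * (frob (Bmx I f xs) + 1).
have Cmu_gt0 : 0 < Cmu by apply: lt_trans hCmu.
have C_gt0 : 0 < C.
  have frob1 p q (M : 'M[R]_(p, q)) : 0 < frob M + 1.
    by rewrite ltr_wpDl ?frob_ge0.
  by apply: addr_gt0; [apply: addr_gt0 | apply: mulr_gt0].
pose delta := (1 - Cmu^-1) * (mumin * (G / 2 / C) ^+ 2).
have delta_gt0 : 0 < delta.
  by rewrite mulr_gt0 // mulr_gt0 // exprn_gt0 // !divr_gt0.
(* The first term keeps gradient norms within [G/2, 2G]; the second makes 2 e D at most delta/2. *)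
pose e := Num.min (G / 2) (delta / (4 * D)).
have e_gt0 : 0 < e.
  rewrite lt_min; apply/andP; split; apply: divr_gt0 => //.
  exact: mulr_gt0.
have e_le : e <= G / 2 by rewrite ge_min lexx.
have e_leD : e <= delta / (4 * D) by rewrite ge_min lexx orbT.
have [r r_gt0 near_xs] : exists2 r : R, 0 < r & forall z, enorm (z - xs) < r ->
    [/\ enorm (g z - g xs) < e, frob (Pmx I f z) <= frob (Pmx I f xs) + 1
      & frob (Bmx I f z) <= frob (Bmx I f xs) + 1].
  apply: nbhs_enormP.
  have cg := continuous_enorm
    (mxcontinuousB_cst (N := grad f xs) (mxcontinuous_grad hf)).
  have cP := continuous_frob (mxcontinuous_Pmx (I := I) hf).
  have cB := continuous_frob (mxcontinuous_Bmx (I := I) hf).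
  have ng : \forall z \near xs, enorm (g z - g xs) < e.
    by move/(_ xs)/cvgr_lt : cg; apply; rewrite subrr enorm0.
  have nP : \forall z \near xs, frob (Pmx I f z) < frob (Pmx I f xs) + 1.
    by move/(_ xs)/cvgr_lt : cP; apply; rewrite ltrDl.
  have nB : \forall z \near xs, frob (Bmx I f z) < frob (Bmx I f xs) + 1.
    by move/(_ xs)/cvgr_lt : cB; apply; rewrite ltrDl.
  by apply: filterS3 ng nP nB => z ? /ltW ? /ltW ?.
have near_G z : enorm (z - xs) < r -> G / 2 <= enorm (g z) <= 2 * G.
  move=> /near_xs[+ _ _] => /lt_le_trans/(_ e_le) gz.
  have := enormD (g z - g xs) (g xs); rewrite subrK => up.
  have := enormD (g z) (- (g z - g xs)); rewrite enormN opprB addrC subrK => lo.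
  have half (a b u : R) : u < b / 2 -> a <= u + b -> b <= a + u ->
      b / 2 <= a <= 2 * b by move=> *; lra.
  exact: half gz up lo.
(* The three terms serve, in order, to exclude the full step, to keep trial points within [r] of
   [xs], and to make the quadratic term of the line search at most delta/2. *)
pose tau := Num.min 1 (Num.min (r / 2 / D) (delta / (8 * c * G ^+ 2))).
have tau_gt0 : 0 < tau.
  rewrite !lt_min ltr01 /=; apply/andP; split; apply: divr_gt0 => //.
    exact: divr_gt0.
  by rewrite mulr_gt0 ?exprn_gt0 // mulr_gt0.
pose w k := objective f (x k) + eps k - objective f (x k.+1).
have w_ge k : exists2 a, line_search_step f c (eps k) (x k)
    (direction I f (l k) (mu k) (x k)) a & c * a ^+ 2 * enorm (g (x k)) ^+ 2 <= w k.
  have [a als xk] := pilm k; exists a => //.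
  case: als => _ + _; rewrite /acceptable /w -xk -/g.
  by move: (_ (x k.+1)) => F1 ?; lra.
have w_cvg0 : w k @[k --> \oo] --> 0.
  apply: summable_perturbation_decrease => // k; first exact: objective_ge0.
  have [a _] := w_ge k; apply: le_trans.
  by rewrite mulr_ge0 ?sqr_ge0 // mulr_ge0 ?sqr_ge0 // ltW.
(* Below this threshold, c a^2 |g|^2 forces a < tau/2 as soon as |g| >= G/2. *)
have eta_gt0 : 0 < c * (tau / 2) ^+ 2 * (G / 2) ^+ 2.
  by apply: mulr_gt0; [apply: mulr_gt0 => //|]; rewrite exprn_gt0 // divr_gt0.
have [N _ w_small] := cvgr_lt _ w_cvg0 _ eta_gt0.
(* Half of the radius is reserved for the segment explored by the line search. *)
have r2_gt0 : 0 < r / 2 by rewrite divr_gt0.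
have [k Nk xk_near] := cluster_seq N clx (nbhs_enorm xs r2_gt0).
have xk_r : enorm (x k - xs) < r.
  by apply: lt_trans xk_near _; rewrite ltr_pdivrMr // ltr_pMr // ltr1n.
have /andP[Gk_ge Gk_le] := near_G _ xk_r.
have [gk_close Pk_le Bk_le] := near_xs _ xk_r.
set d := direction I f (l k) (mu k) (x k).
have [a [[j aE] _ a_max] wa] := w_ge k.
have d_le : enorm d <= D.
  apply: le_trans (enorm_direction hmumin hCmu (muE k) _) _.
  by rewrite ler_pM2r // invr_gt0 mulr_gt0.
have a_gt0 : 0 < a by rewrite aE invr_gt0 exprn_gt0.
have a_lt : a < tau / 2.
  have : (a * enorm (g (x k))) ^+ 2 < (tau / 2 * (G / 2)) ^+ 2.
    rewrite -(ltr_pM2l hc) (exprMn _ a) (exprMn _ (tau / 2))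
      (mulrA c (a ^+ 2)) (mulrA c ((tau / 2) ^+ 2)).
    exact: le_lt_trans wa (w_small k Nk).
  rewrite ltr_sqr ?nnegrE ?mulr_ge0 ?divr_ge0 ?enorm_ge0 // ?ltW //.
  move=> agt; rewrite ltNge; apply/negP => ta; move: agt; rewrite ltNge.
  by rewrite ler_pM // ltW // divr_gt0.
(* The accepted step is below 1/2, so its exponent is positive and its double is again a candidate
   of the backtracking. *)
have [j' t_eq] : exists j', 2 * a = 2 ^- j' :> R.
  case: j aE => [aE|j' ->]; last first.
    by exists j'; rewrite exprS invfM mulrA mulfV ?pnatr_eq0 // mul1r.
  have tau_le1 : tau <= 1 by rewrite ge_min lexx.
  move: a_lt; rewrite aE expr0 invr1 ltr_pdivlMr // mul1r.
  by move=> /lt_le_trans/(_ tau_le1); rewrite ltNge ler1n.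
have t_gt0 : 0 < 2 * a by rewrite mulr_gt0.
have t_lt : 2 * a < tau by rewrite mulrC -ltr_pdivlMr.
suff /a_max : acceptable f c (eps k) (x k) d (2 ^- j').
  by rewrite -t_eq; apply/negP; rewrite -ltNge ltr_pMl // ltr1n.
rewrite -t_eq; have [df _] := hf.
(* The tolerance doubles because the gradients at [x k] and at the trial point are each compared
   with the one at [xs]. *)
apply: (acceptable_small_step (e := 2 * e) (delta := delta)) => //.
- move=> s /andP[s_gt0 s_lt].
  have sd_le : enorm (s *: d) <= r / 2.
    rewrite enormZ (gtr0_norm s_gt0).
    apply: (@le_trans _ _ (r / 2 / D * D)); last by rewrite divfK ?gt_eqF.
    rewrite ler_pM ?enorm_ge0 ?(ltW s_gt0) //.
    apply: le_trans (ltW (lt_trans s_lt t_lt)) _.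
    by rewrite ge_min; apply/orP; right; rewrite ge_min lexx.
  have z_near : enorm (x k + s *: d - xs) < r.
    rewrite addrAC; apply: le_lt_trans (enormD _ _) _.
    by rewrite [ltRHS]splitr ltr_leD.
  have [gz_close _ _] := near_xs _ z_near.
  rewrite -[_ - _](subrKA (g xs)); apply: le_trans (enormD _ _) _.
  rewrite -[enorm (g xs - _)]enormN opprB mulr_natl mulr2n.
  by rewrite lerD // ltW.
- have PB_le : frob (Pmx I f (x k)) + mumin + Cmu * frob (Bmx I f (x k)) <= C.
    by rewrite lerD ?lerD2r // ler_pM2l.
  apply: le_trans (direction_descent hmumin hCmu (muE k) (l k) PB_le).
  rewrite ler_pM2l // ler_pM2l // ler_sqr ?nnegrE.
  + by rewrite ler_pM2r ?invr_gt0.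
  + by apply: divr_ge0; [apply: divr_ge0 => //|]; exact: ltW.
  + by apply: divr_ge0; [exact: enorm_ge0 | exact: ltW].
have eD : e * enorm d <= delta / 4.
  apply: (@le_trans _ _ (delta / (4 * D) * D)).
    by rewrite ler_pM ?enorm_ge0 ?(ltW e_gt0).
  by rewrite invfM (mulrA delta) divfK ?gt_eqF.
have cG : c * (2 * a) * enorm (g (x k)) ^+ 2 <= delta / 2.
  have cG2 : c * tau * (2 * G) ^+ 2 <= delta / 2.
    have : tau <= delta / (8 * c * G ^+ 2).
      by rewrite ge_min; apply/orP; right; rewrite ge_min lexx orbT.
    rewrite ler_pdivlMr; last by rewrite mulr_gt0 ?exprn_gt0 // mulr_gt0.
    have -> u v : c * u * (2 * v) ^+ 2 = u * (8 * c * v ^+ 2) / 2 by field.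
    by rewrite ler_pM2r ?invr_gt0.
  apply: le_trans cG2; rewrite ler_pM ?sqr_ge0 //.
  + by rewrite mulr_ge0 // ltW.
  + by rewrite ler_pM2l // ltW.
  + by rewrite ler_sqr ?nnegrE ?enorm_ge0 // mulr_ge0 // ltW.
(* The descent [delta] is spent half on the gradient variation and half on the quadratic term. *)
apply: (@le_trans _ _ (delta / 2 + delta / 2)); last by rewrite -splitr.
have quarterK (u : R) : 2 * (u / 4) = u / 2 by field.
by rewrite lerD // -mulrA -quarterK ler_pM2l.
Qed.
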